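(* Let $\mathbb A\in\mathbb R^{N\times N}$ be a symmetric positive definite matrix with eigenvalues $0<\lambda_1\le\lambda_2\le\dots\le\lambda_N$, let $\alpha\in(0,1)$, let $k$ be a positive integer, and let $\mathbf f\in\mathbb R^N$, $\mathbf f\neq 0$. Put $\Lambda=\|\mathbb A\|_\infty=\max_{1\le i\le N}\sum_{j=1}^N|a_{ij}|$, $\mathcal A=\Lambda^{-1}\mathbb A$ and $\mu_1=\Lambda^{-1}\lambda_1$. Let $r_{1-\alpha}\in\mathcal R(k,k)$ be the best uniform rational approximation of $t^\alpha$ on $[0,1]$, let $E_{1-\alpha,k,k}=\max_{t\in[0,1]}|r_{1-\alpha}(t)-t^\alpha|$, and let $\xi_1<\xi_2<\dots<\xi_{2k+1}$ be the roots in $(0,1)$ of $\varepsilon(t)=r_{1-\alpha}(t)-t^\alpha$. Let $\mathbf u=\mathbb A^{-\alpha}\mathbf f$ and $\mathbf u_r=\Lambda^{-\alpha}\,r_{1-\alpha}(\mathcal A)^{-1}\mathbf f$. If $$\mu_1\in\bigcup_{i=1}^k[\xi_{2i},\xi_{2i+1}],$$ then $$\frac{\|\mathbf u_r-\mathbf u\|_2}{\|\mathbf f\|_2}\le\frac{\Lambda^{\alpha}E_{1-\alpha,k,k}}{\lambda_1^{2\alpha}}.$$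
   Context: $\|\cdot\|_2$ is the Euclidean norm. Functions of symmetric matrices (fractional powers $\mathbb A^{-\alpha}$ and rational functions $r(\mathcal A)$) are defined through the spectral decomposition; the spectrum of $\mathcal A$ lies in $(0,1]$. $\mathcal R(k,m)$ is the class of rational functions $r(t)=P_k(t)/Q_m(t)$ with real polynomials $P_k$ of degree at most $k$ and $Q_m$ of degree at most $m$, with $Q_m$ normalized to be monic. The best uniform rational approximation of $t^\alpha$ in $\mathcal R(k,k)$ is the minimizer $r_{1-\alpha}=\operatorname{argmin}_{r\in\mathcal R(k,k)}\|t^{\alpha}-r(t)\|_{L^\infty(0,1)}$ (the index convention is that $r_\beta$ approximates $t^{1-\beta}$). Known facts: $r_{1-\alpha}$ exists and is unique, its numerator and denominator have exact degree $k$, and the error function $\varepsilon$ has $2k+2$ extreme points in $[0,1]$ including both endpoints, and exactly $2k+1$ roots in $(0,1)$. The function $r_{1-\alpha}$ is positive on $[0,1]$, so $r_{1-\alpha}(\mathcal A)^{-1}$ is well defined. The vector $\mathbf u_r$ is called the $(k,k)$-R-BURA approximation of $\mathbf u$. *)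

(* Defs.v *)
From HB Require Import structures.
From mathcomp Require Import all_boot all_order all_algebra.
From mathcomp Require Import all_classical all_reals all_analysis.
Set Implicit Arguments.
Unset Strict Implicit.
Unset Printing Implicit Defensive.
Import Order.TTheory GRing.Theory Num.Theory.
Import numFieldNormedType.Exports.
Local Open Scope classical_set_scope.
Local Open Scope ring_scope.

Section MatrixNotions.
Context {R : realType}.

(* The library norm on matrices is the entrywise maximum norm. *)
Definition norm2 {n} (v : 'cV[R]_n) : R := Num.sqrt (\sum_(i < n) v i 0 ^+ 2).

Definition norm_inf {n} (A : 'M[R]_n) : R :=
  \big[Num.max/0]_(i < n) \sum_(j < n) `|A i j|.

Definition sympd {n} (A : 'M[R]_n) : Prop :=
  A^T = A /\ forall x : 'cV[R]_n, x != 0 -> 0 < (x^T *m A *m x) 0 0.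

(* lam 1 <= ... <= lam n (indices start at 1) are the eigenvalues of A, listed
   with multiplicity; the values of lam outside {1, ..., n} are irrelevant. *)
Definition ordered_eigenvalues {n} (A : 'M[R]_n) (lam : nat -> R) : Prop :=
  (forall i j : nat, (1 <= i)%N -> (i <= j)%N -> (j <= n)%N ->
     lam i <= lam j) /\
  char_poly A = \prod_(1 <= i < n.+1) ('X - (lam i)%:P).

(* B = g(A) with respect to the orthogonal diagonalization A = U^T diag(d) U. *)
Definition spectral_image {n} (g : R -> R) (A B : 'M[R]_n) : Prop :=
  exists (U : 'M[R]_n) (d : 'rV[R]_n),
    [/\ U *m U^T = 1%:M,
        A = U^T *m diag_mx d *m U &
        B = U^T *m diag_mx (map_mx g d) *m U].

Lemma spectral_image_unique {n} (g : R -> R) (A B C : 'M[R]_n) :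
  spectral_image g A B -> spectral_image g A C -> B = C.
Proof.
move=> [U [d [UU -> ->]]] [V [e [VV AE ->]]].
have UU' := mulmx1C UU; have VV' := mulmx1C VV.
pose W := V *m U^T.
have WE : W *m diag_mx d = diag_mx e *m W.
  rewrite /W; move/(congr1 (fun M => V *m M *m U^T)): AE.
  rewrite !mulmxA VV mul1mx -[X in X = _]mulmxA UU mulmx1.
  by move=> ->; rewrite -!mulmxA.
have WgE : W *m diag_mx (map_mx g d) = diag_mx (map_mx g e) *m W.
  clearbody W; apply/matrixP => i j; move/matrixP/(_ i j): WE.
  rewrite !mul_mx_diag !mul_diag_mx !mxE.
  have [->|W0] := eqVneq (W i j) 0; first by rewrite !(mul0r, mulr0).
  by rewrite [_ * W i j]mulrC => /(mulfI W0) ->; rewrite mulrC.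
move/(congr1 (fun M => V^T *m M *m U)): WgE.
by rewrite /W !mulmxA VV' mul1mx -[X in _ = X]mulmxA UU' mulmx1.
Qed.

(* The function g of a symmetric matrix; every symmetric A has such an image,
   by the spectral theorem, and the default value 0 is used only for
   non-symmetric A. *)
Definition mxfun {n} (g : R -> R) (A : 'M[R]_n) : 'M[R]_n :=
  xget 0 [set B | spectral_image g A B].

End MatrixNotions.

Section RationalApproximation.
Context {R : realType}.

(* The class R(k, m).  At a zero of Q the quotient takes the conventional value
   0; this affects only finitely many points, hence no L^oo norm. *)
Definition ratclass (k m : nat) : set (R -> R) :=
  [set r | exists P Q : {poly R},
     [/\ (size P <= k.+1)%N, (size Q <= m.+1)%N, Q \is monic &
         r = fun t => P.[t] / Q.[t]]].

Definition Linf01 (g : R -> R) : \bar R :=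
  Lnorm (mrestr (@lebesgue_measure R) (measurable_itv `]0, 1[)) +oo%E
        (EFin \o g).

Definition best_approx (k m : nat) (g r : R -> R) : Prop :=
  ratclass k m r /\
  forall q, ratclass k m q ->
    (Linf01 (fun t => g t - r t)%R <= Linf01 (fun t => g t - q t)%R)%E.

Definition is_max (S : set R) (x : R) : Prop := S x /\ ubound S x.

End RationalApproximation.

(* Main.v *)
Require Import Defs.
From mathcomp Require Import all_boot all_order all_algebra.
From mathcomp Require Import all_classical all_reals all_analysis.
From mathcomp Require Import ring lra zify.
Import Order.TTheory GRing.Theory Num.Theory.
Import numFieldNormedType.Exports.
Local Open Scope classical_set_scope.
Local Open Scope ring_scope.

Set Implicit Arguments.
Unset Strict Implicit.
Unset Printing Implicit Defensive.

(* Write r = P/Q.  The function P(t) - t^al Q(t) is a combination of the 2k+2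
   powers t^i, t^(i+al), i <= k, with 2k+1 distinct positive zeros.  By Rolle's
   theorem this is the largest possible number (Descartes' rule for real
   exponents), whence all coefficients p_i of P and q_i of Q are positive, the
   zeros are simple, there are no others, and the error is nonnegative on the
   intervals [xi_2i, xi_(2i+1)].  Killing all powers except those with exponents
   i, i+al, i+1, i+1+al leaves three zeros of a function with four terms; this
   forces p_i q_(i+1) <= p_(i+1) q_i, so that r is nondecreasing on (0, oo).
   Therefore r(t) >= r(mu1) >= mu1^al for t >= mu1, and
   |1/r(t) - t^(-al)| = |r(t) - t^al| / (r(t) t^al) <= E / mu1^(2 al) on the
   spectrum, which lies in [mu1, 1].  Only the membership of r in R(k, k) and
   the number of roots of the error enter. *)

(** * Zeros of exponential sums *)

(** Rolle's theorem on each gap between consecutive zeros. The strict bounds by [a] and by the last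
    zero make it possible to concatenate critical points found on the two sides of a given point. *)
Lemma rolle_path (R : realType) (f f' : R -> R) (a : R) (s : seq R) :
  (forall x : R, is_derive x 1 f (f' x)) ->
  path <%R a s -> (forall x, x \in a :: s -> f x = 0) ->
  exists s', [/\ size s' = size s, path <%R a s',
    all (< last a s) s' & forall x, x \in s' -> f' x = 0].
Proof.
move=> df; elim: s a => [|b s IH] a /=; first by exists [::].
move=> /andP[ab pbs] fz.
have [|s' [ss pbs' lts' fz']] := IH b pbs.
  by move=> x xs; apply: fz; rewrite inE xs orbT.
have [|||c] := @Rolle R f a b ab.
- by move=> x _; exact: ex_derive.
- apply: continuous_subspaceT => x.
  by apply/differentiable_continuous/derivable1_diffP; exact: ex_derive.
- by rewrite !fz ?inE ?eqxx ?orbT.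
rewrite in_itv /= => /andP[ac cb] dfc.
exists (c :: s'); rewrite /= ss; split => //.
- rewrite ac /= ; case: s' pbs' {ss lts' fz'} => //= d s' /andP[bd ->].
  by rewrite (lt_trans cb bd).
- rewrite lts' andbT (lt_le_trans cb) //.
  have := mem_last b s; rewrite inE => /predU1P[->//|ls].
  by apply/ltW; move/allP: (order_path_min lt_trans pbs); apply.
move=> x; rewrite inE => /predU1P[->|/fz' //].
by have := derive_val (is_derive := df c); rewrite (derive_val (is_derive := dfc)).
Qed.

Definition expsum (R : realType) (n : nat) (c e : nat -> R) (x : R) : R :=
  \sum_(l < n) c l * expR (e l * x).

Lemma is_derive_expR_scale (R : realType) (b x : R) :
  is_derive x 1%R (fun y : R => expR (b * y)) (b * expR (b * x)).
Proof.
have hb : is_derive x 1%R (fun y : R => b * y) b.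
  have := is_deriveZ b (is_derive_id x 1%R).
  by rewrite /GRing.scale /= mulr1.
have := is_derive1_comp (is_derive_expR (b * x)) hb.
by rewrite mulrC.
Qed.

Lemma is_derive_expsum (R : realType) (n : nat) (c e : nat -> R) (x : R) :
  is_derive x 1%R (expsum n c e) (expsum n (fun l => c l * e l) e x).
Proof.
have -> : expsum n c e = \sum_(l < n) (fun y : R => c l * expR (e l * y)).
  by apply/funext => y; rewrite fct_sumE.
rewrite /expsum; apply: is_derive_sum => l.
have := is_deriveZ (c l) (is_derive_expR_scale (e l) x).
by rewrite /GRing.scale /= mulrA.
Qed.

Lemma expsum_shift (R : realType) (n : nat) (c e : nat -> R) (b x : R) :
  expsum n c (fun l => e l - b) x = expR (- (b * x)) * expsum n c e x.
Proof.
rewrite /expsum mulr_sumr; apply: eq_bigr => l _.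
by rewrite mulrBl expRD mulrA [LHS]mulrC.
Qed.

(* [exp (b x) * d/dx (exp (- b x) * F)] multiplies the coefficient of
   [exp (e x)] in [F] by [e - b]; it kills the exponent [b] and loses at most
   one zero. *)
Lemma rolle_expsum (R : realType) (n : nat) (c e : nat -> R) (b a : R)
    (s : seq R) :
  path <%R a s -> (forall x, x \in a :: s -> expsum n c e x = 0) ->
  exists s', [/\ size s' = size s, path <%R a s',
    all (< last a s) s' &
    forall x, x \in s' -> expsum n (fun l => c l * (e l - b)) e x = 0].
Proof.
move=> pas fz.
have [|s' [ss ps ls fz']] :=
  rolle_path (@is_derive_expsum R n c (fun l => e l - b)) pas.
  by move=> x /fz fx; rewrite expsum_shift fx mulr0.
exists s'; split => // x /fz' /eqP.
by rewrite expsum_shift mulf_eq0 gt_eqF ?expR_gt0 //= => /eqP.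
Qed.

(** Iterates [rolle_expsum] over [K], at the price of at most one zero per exponent. *)
Lemma kill_exponents (R : realType) (K : seq R) (n : nat) (c e : nat -> R)
    (z : seq R) :
  sorted <%R z -> (forall x, x \in z -> expsum n c e x = 0) ->
  exists z', [/\ (size z <= size z' + size K)%N, sorted <%R z' &
    forall x, x \in z' ->
      expsum n (fun l => c l * \prod_(k <- K) (e l - k)) e x = 0].
Proof.
elim: K c z => [|b K IH] c z sz fz.
  exists z; rewrite addn0; split => // x /fz <-.
  by apply: eq_bigr => l _; rewrite big_nil mulr1.
case: z sz fz => [|a s] /= sz fz; first by exists [::].
have [s' [ss ps ls fz']] := rolle_expsum b sz fz.
have [z' [sz' pz' fz'']] := IH _ _ (path_sorted ps) fz'.
exists z'; split => //; first by rewrite addnS ltnS -ss.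
move=> x /fz'' <-; apply: eq_bigr => l _.
by rewrite big_cons !mulrA.
Qed.


(* Up to a sign independent of [i], the factor by which the coefficient of
   [exp (e i x)] is multiplied when all exponents of index outside
   [[l, l + m)] are killed. *)
Definition outer_weight (R : realType) (n : nat) (e : nat -> R) (l m i : nat) : R :=
  \prod_(0 <= j < l) (e i - e j) * \prod_(l + m <= j < n) (e j - e i).

(** Kills the [n - m] exponents outside a block of [m] consecutive ones. The sign common to all the
    resulting factors does not affect the zeros and is dropped. *)
Lemma keep_exponents (R : realType) (n l m : nat) (c e : nat -> R)
    (z : seq R) :
  (l + m <= n)%N -> sorted <%R z ->
  (forall x, x \in z -> expsum n c e x = 0) ->
  exists z', [/\ (size z + m <= size z' + n)%N, sorted <%R z' &
    forall x, x \in z' ->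
      expsum m (fun i => c (l + i)%N * outer_weight n e l m (l + i))
        (fun i => e (l + i)%N) x = 0].
Proof.
move=> lmn sz fz.
pose K := map e (index_iota 0 l ++ index_iota (l + m) n).
have [z' [szz pz' fz']] := kill_exponents K sz fz.
have sK : size K = (n - m)%N.
  by rewrite /K size_map size_cat !size_iota; lia.
exists z'; split => //; first by move: szz; rewrite sK; lia.
move=> x /fz' fx.
have wE i : \prod_(k <- K) (e i - k) =
    (-1) ^+ (n - (l + m)) * outer_weight n e l m i.
  rewrite /K big_map big_cat /outer_weight mulrCA; congr (_ * _).
  rewrite -prodr_const_nat -big_split; apply: eq_bigr => j _ /=.
  by rewrite mulN1r opprB.
have w0 i : (i < n)%N -> ~~ (l <= i < l + m)%N -> outer_weight n e l m i = 0.
  move=> i_n im; apply/eqP; rewrite mulf_eq0 !prodf_seq_eq0.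
  have [il|li] := ltnP i l.
    by apply/orP; left; apply/hasP; exists i; rewrite ?mem_index_iota //= subrr.
  apply/orP; right; apply/hasP; exists i; rewrite /= ?subrr//.
  by rewrite mem_index_iota; lia.
have : expsum n (fun i => c i * outer_weight n e l m i) e x = 0.
  apply: (@mulfI _ ((-1) ^+ (n - (l + m)))); first by rewrite signr_eq0.
  rewrite mulr0 -{}fx /expsum mulr_sumr; apply: eq_bigr => i _.
  by rewrite wE; ring.
move=> <-; rewrite /expsum.
rewrite -[RHS](big_mkord xpredT (fun i => c i * outer_weight n e l m i * expR (e i * x))).
rewrite (@big_cat_nat _ _ _ l) //=; last by lia.
rewrite (@big_cat_nat _ _ _ (l + m) l n) //=; last by lia.
rewrite [X in _ = X + _]big_nat_cond [X in _ = X + _]big1 ?add0r; last first.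
  by move=> i ?; rewrite w0 ?mulr0 ?mul0r //; lia.
rewrite [X in _ = _ + X]big_nat_cond [X in _ = _ + X]big1 ?addr0; last first.
  by move=> i ?; rewrite w0 ?mulr0 ?mul0r //; lia.
rewrite -[X in \sum_(X <= _ < _) _]add0n big_addn addKn big_mkord.
by apply: eq_bigr => i _; rewrite addnC.
Qed.

Lemma outer_weight_gt0 (R : realType) (n : nat) (e : nat -> R) (l m i : nat) :
  (forall i j, (i < j < n)%N -> e i < e j) -> (l <= i < l + m)%N -> (l + m <= n)%N ->
  0 < outer_weight n e l m i.
Proof.
move=> he il lmn; rewrite mulr_gt0 // big_nat_cond prodr_gt0 // => j jl;
  by rewrite subr_gt0 he //; lia.
Qed.

(** Keeping the single term [l] costs [n - 1] zeros, so one is left; but an exponential vanishes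
    nowhere. *)
Lemma expsum_eq0 (R : realType) (n : nat) (c e : nat -> R) (z : seq R) :
  (forall i j, (i < j < n)%N -> e i < e j) ->
  sorted <%R z -> (n <= size z)%N ->
  (forall x, x \in z -> expsum n c e x = 0) ->
  forall l, (l < n)%N -> c l = 0.
Proof.
move=> he sz nz fz l ln.
have l1n : (l + 1 <= n)%N by rewrite addn1.
have [[|x z'] [szz _ fz']] := keep_exponents l1n sz fz.
  by move: szz nz => /=; lia.
have w0 : 0 < outer_weight n e l 1 l by apply: outer_weight_gt0 => //; lia.
have /eqP := fz' x (mem_head _ _); rewrite /expsum big_ord1 /= addn0.
rewrite mulf_eq0 (gt_eqF (expR_gt0 _)) orbF mulf_eq0 (gt_eqF w0) orbF.
by move=> /eqP.
Qed.

(** Keeping two neighbouring terms leaves at least one zero, at which the two positively weighted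
    terms must cancel. *)
Lemma expsum_alternate (R : realType) (n : nat) (c e : nat -> R) (z : seq R) :
  (forall i j, (i < j < n)%N -> e i < e j) ->
  sorted <%R z -> (n <= (size z).+1)%N ->
  (forall x, x \in z -> expsum n c e x = 0) ->
  forall l, (l.+1 < n)%N -> exists2 t, 0 < t & c l.+1 = - (t * c l).
Proof.
move=> he sz nz fz l ln.
have l2n : (l + 2 <= n)%N by rewrite addn2.
have [[|x z'] [szz _ fz']] := keep_exponents l2n sz fz.
  by move: szz nz => /=; lia.
have := fz' x (mem_head _ _).
rewrite /expsum 2!big_ord_recr big_ord0 /= add0r addn0 addn1.
set a := outer_weight _ _ _ _ _; set b := outer_weight _ _ _ _ _.
have a0 : 0 < a by apply: outer_weight_gt0 => //; lia.
have b0 : 0 < b by apply: outer_weight_gt0 => //; lia.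
move: (expR_gt0 (e l * x)) (expR_gt0 (e l.+1 * x)).
set p := expR _; set q := expR _; clearbody a b => p0 q0 H.
exists (a * p / (b * q)); first by rewrite divr_gt0 ?mulr_gt0.
have bq0 : b * q != 0 by rewrite lt0r_neq0 ?mulr_gt0.
apply: (mulIf bq0); rewrite mulNr mulrAC divfK //.
by move: H; lra.
Qed.

(** * Four-term sums and the ratios of the coefficients *)

Lemma three_zeros_bound (R : realType) (al a0 b0 a1 b1 : R) (z : seq R) :
  0 < al < 1 -> 0 < a0 -> 0 < b0 -> 0 < a1 -> 0 < b1 ->
  sorted <%R z -> (2 < size z)%N ->
  (forall x, x \in z ->
     a0 + a1 * expR x = expR (al * x) * (b0 + b1 * expR x)) ->
  a0 * b1 * (1 + al) ^+ 2 <= a1 * b0 * (1 - al) ^+ 2.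
Proof.
move=> /andP[al0 al1] a00 b00 a10 b10.
(* With [T = exp x], the critical points of
   [exp (- al x) * (a0 + a1 T) / (b0 + b1 T)] are the roots of a quadratic in
   [T]: two positive roots force a nonnegative discriminant. *)
case: z => [|z0 [|z1 [|z2 z]]] //= sz _ fz.
pose c0 (l : nat) := if l == 0%N then a0 else a1.
pose e0 (l : nat) : R := if l == 0%N then - al else 1 - al.
pose c1 (l : nat) := if l == 0%N then b0 else b1.
pose e1 (l : nat) : R := if l == 0%N then 0 else 1.
pose n := expsum 2 c0 e0; pose d := expsum 2 c1 e1.
have nE x : n x = expR (- (al * x)) * (a0 + a1 * expR x).
  rewrite /n /expsum 2!big_ord_recr big_ord0 /= /c0 /e0 /=.
  by rewrite mulrBl mul1r mulNr expRD; ring.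
have n'E x : expsum 2 (fun l => c0 l * e0 l) e0 x =
    expR (- (al * x)) * (- al * a0 + (1 - al) * a1 * expR x).
  rewrite /expsum 2!big_ord_recr big_ord0 /= /c0 /e0 /=.
  by rewrite mulrBl mul1r mulNr expRD; ring.
have dE x : d x = b0 + b1 * expR x.
  rewrite /d /expsum 2!big_ord_recr big_ord0 /= /c1 /e1 /=.
  by rewrite mul0r expR0 mul1r; ring.
have d'E x : expsum 2 (fun l => c1 l * e1 l) e1 x = b1 * expR x.
  rewrite /expsum 2!big_ord_recr big_ord0 /= /c1 /e1 /=.
  by rewrite mul1r; ring.
have d0 x : d x != 0.
  by rewrite dE lt0r_neq0 // addr_gt0 // mulr_gt0 // expR_gt0.
pose f x := n x / d x - 1.
have df (x : R) : is_derive x 1%R f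
    (n x * (- d x ^- 2 * expsum 2 (fun l => c1 l * e1 l) e1 x)
     + (d x)^-1 * expsum 2 (fun l => c0 l * e0 l) e0 x - 0).
  have dn := is_derive_expsum 2 c0 e0 x.
  have dd := is_deriveV (d0 x) (is_derive_expsum 2 c1 e1 x).
  exact: (is_deriveB (is_deriveM dn dd) (is_derive_cst (1 : R) x 1%R)).
have [|s' [ss ps _ fz']] := rolle_path df (a := z0) (s := [:: z1, z2 & z]) sz.
  move=> x /fz H; rewrite /f; apply/eqP.
  rewrite subr_eq0 nE H mulrA -expRD addNr expR0 mul1r -dE divff //.
case: s' ss ps fz' => [|x [|y s']] //= _ /and3P[_ xy _] fz'.
(* The vanishing derivative, cleared of its denominator and of the factor [expR (- (al * t))], is
   the quadratic in [expR t]. *)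
have key t : t \in [:: x, y & s'] ->
    al * a1 * b1 * expR t ^+ 2 - ((1 - al) * a1 * b0 - (1 + al) * a0 * b1) * expR t
      + al * a0 * b0 = 0.
  move=> /fz'; rewrite subr0 n'E d'E nE => /(congr1 (fun y => y * (d t ^+ 2 / expR (- (al * t))))).
  rewrite mul0r => H; apply/eqP; rewrite -oppr_eq0; apply/eqP; rewrite -{}[RHS]H.
  have dt := d0 t; have et := lt0r_neq0 (expR_gt0 (- (al * t))).
  rewrite [RHS](_ : _ = - (a0 + a1 * expR t) * (b1 * expR t)
     + d t * (- al * a0 + (1 - al) * a1 * expR t)); last by field; rewrite dt et.
  by rewrite dE; ring.
have Kx := key x (mem_head _ _).
have yin : y \in [:: x, y & s'] by rewrite !inE eqxx orbT.
have Ky := key y yin.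
move: Kx Ky; have : expR x < expR y by rewrite ltr_expR.
move: (expR_gt0 x) (expR_gt0 y); set S := expR x; set T := expR y.
move=> S0 T0 ST; set M := (_ * b0 - _) => KS KT.
(* Vieta's formulas for the distinct roots [S] and [T]: their sum here, their product in [CE]. *)
have ME : M = al * a1 * b1 * (S + T).
  apply: (@mulIf _ (T - S)); first by rewrite subr_eq0 gt_eqF.
  by lra.
have CE : al * a0 * b0 = al * a1 * b1 * (S * T) by rewrite ME in KS; lra.
have aa0 : 0 < al * a1 * b1 by rewrite !mulr_gt0.
have M0 : 0 < M by rewrite ME mulr_gt0 ?addr_gt0.
have XY : a0 * b1 < a1 * b0.
  have ab1 : 0 < a0 * b1 by rewrite mulr_gt0.
  rewrite -(@ltr_pM2l _ (1 - al)) ?subr_gt0 //; move: M0; rewrite /M => M0.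
  have : 0 < al * (a0 * b1) by rewrite mulr_gt0.
  by lra.
(* The discriminant has the factor [a1 * b0 - a0 * b1], positive by [XY]; the other factor, whose
   sign is the claim, is therefore nonnegative. *)
have disc : M ^+ 2 - 4 * al * al * (a1 * b0) * (a0 * b1) =
   (a1 * b0 * (1 - al) ^+ 2 - a0 * b1 * (1 + al) ^+ 2) * (a1 * b0 - a0 * b1).
  by rewrite /M; ring.
rewrite -subr_ge0 -(@pmulr_lge0 _ (a1 * b0 - a0 * b1)) ?subr_gt0 // -disc.
have -> : 4 * al * al * (a1 * b0) * (a0 * b1) = 4 * (al * a1 * b1) * (al * a0 * b0).
  by ring.
rewrite CE ME.
have -> : (al * a1 * b1 * (S + T)) ^+ 2 -
    4 * (al * a1 * b1) * (al * a1 * b1 * (S * T)) = (al * a1 * b1 * (S - T)) ^+ 2.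
  by ring.
exact: sqr_ge0.
Qed.

(** Lists 0, al, 1, 1 + al, 2, 2 + al, ... in increasing order: even indices carry the powers from
    [P], odd ones those from [Q]. *)
Definition exponent (R : realType) (al : R) (l : nat) : R :=
  l./2%:R + (odd l)%:R * al.

Lemma exponent_lt (R : realType) (al : R) (i j : nat) :
  0 < al < 1 -> (i < j)%N -> exponent al i < exponent al j.
Proof.
move=> /andP[al0 al1] ij; rewrite /exponent.
have [ij2|ij2] := ltnP i./2 j./2.
  have : i./2%:R + 1 <= j./2%:R :> R by rewrite natr1 ler_nat.
  by case: (odd i); case: (odd j) => /= H; lra.
have E : i./2 = j./2 by apply/eqP; rewrite eqn_leq half_leq // ltnW.
have [-> ->] : odd i = false /\ odd j = true.
  move: (odd_double_half i) (odd_double_half j); rewrite E.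
  by case: (odd i); case: (odd j) => /= Hi Hj; split => //; exfalso; lia.
by rewrite E mul0r mul1r; lra.
Qed.

Lemma big_nat_double (T : Type) (idx : T) (op : Monoid.law idx)
    (g : nat -> T) (m : nat) :
  \big[op/idx]_(0 <= j < m.*2) g j =
  \big[op/idx]_(0 <= j < m) op (g j.*2) (g j.*2.+1).
Proof.
elim: m => [|m IH]; first by rewrite !big_geq.
by rewrite doubleS !big_nat_recr //= IH Monoid.mulmA.
Qed.

Lemma exponent_even (R : realType) (al : R) (m : nat) :
  exponent al m.*2 = m%:R.
Proof. by rewrite /exponent odd_double doubleK mul0r addr0. Qed.

Lemma exponent_odd (R : realType) (al : R) (m : nat) :
  exponent al m.*2.+1 = m%:R + al.
Proof. by rewrite /exponent /= odd_double uphalf_double mul1r. Qed.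

(* The products over a block of [m] killed pairs of exponents: with
   [x = j + 1], the factors are the differences between [0, al, 1, 1 + al] and
   [- x, - x + al], or between the latter and [1 + x, 1 + x + al]. *)
Definition num_block (R : realType) (al : R) (m : nat) : R :=
  \prod_(0 <= j < m)
     (j.+1%:R * (j.+1%:R + al) * (j.+2%:R - al) * j.+2%:R).

Definition den_block (R : realType) (al : R) (m : nat) : R :=
  \prod_(0 <= j < m)
     (j.+1%:R * (j.+1%:R - al) * (j.+2%:R + al) * j.+2%:R).

(** The quotient of the two blocks telescopes: with the factors [1 - al] and [1 + al] it equals (m +
    1 - al) / (m + 1 + al), which is at most 1. *)
Lemma block_bound (R : realType) (al : R) (m : nat) :
  0 < al < 1 ->
  0 <= num_block al m * (1 - al) <= den_block al m * (1 + al).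
Proof.
move=> /andP[al0 al1].
have E : num_block al m * (1 - al) * (m.+1%:R + al) =
         den_block al m * (1 + al) * (m.+1%:R - al).
  rewrite /num_block /den_block; elim: m => [|m IH].
    by rewrite !big_geq //; ring.
  rewrite !big_nat_recr //=.
  set N := \prod_(_ <= _ < _) _ in IH *; set D := \prod_(_ <= _ < _) _ in IH *.
  transitivity (N * (1 - al) * (m.+1%:R + al) *
     (m.+1%:R * (m.+2%:R - al) * m.+2%:R * (m.+2%:R + al))); first by ring.
  by rewrite IH; ring.
have m1 : 1 <= m.+1%:R :> R by rewrite ler1n.
have N0 : 0 <= num_block al m.
  rewrite /num_block prodr_ge0 // => j _.
  have j1 : 1 <= j.+1%:R :> R by rewrite ler1n.
  have j2 : 1 <= j.+2%:R :> R by rewrite ler1n.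
  by rewrite !mulr_ge0 //; lra.
have D0 : 0 <= den_block al m.
  rewrite /den_block prodr_ge0 // => j _.
  have j1 : 1 <= j.+1%:R :> R by rewrite ler1n.
  have j2 : 1 <= j.+2%:R :> R by rewrite ler1n.
  by rewrite !mulr_ge0 //; lra.
rewrite mulr_ge0 /=; [|by []|lra].
have m0 : 0 < m.+1%:R + al by lra.
rewrite -(ler_pM2r m0) E; apply: ler_wpM2l; last by lra.
by rewrite mulr_ge0 //; lra.
Qed.

(** [three_zeros_bound] involves the weights only through the product of the two middle ones and
    that of the two extreme ones. Relative to the block, the reflection x -> 1 + al - x swaps the
    members of each pair and carries killed exponents below the block to exponents of the form
    killed above it, so both sides give blocks of the same shape. *)
Lemma outer_weight_blocks (R : realType) (al : R) (k i : nat) :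
  (i < k)%N ->
  let w := outer_weight k.+1.*2 (exponent al) i.*2 4 in
  w i.*2.+1 * w i.*2.+2 = num_block al i * num_block al (k - i.+1) /\
  w i.*2 * w i.*2.+3 = den_block al i * den_block al (k - i.+1).
Proof.
move=> ik w; rewrite /w /outer_weight.
have lowE a b : \prod_(0 <= j < i.*2) (exponent al (i.*2 + a) - exponent al j) *
    \prod_(0 <= j < i.*2) (exponent al (i.*2 + b) - exponent al j) =
    \prod_(0 <= j < i) ((exponent al a + j.+1%:R) * (exponent al a + j.+1%:R - al) *
      ((exponent al b + j.+1%:R) * (exponent al b + j.+1%:R - al))).
  (* After the reversal, [j] counts the killed pairs downwards from the block. *)
  rewrite !big_nat_double [X in X * _]big_nat_rev [X in _ * X]big_nat_rev.
  rewrite -big_split [LHS]big_nat_cond [RHS]big_nat_cond.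
  apply: eq_bigr => j /andP[ji _]; rewrite add0n exponent_even exponent_odd.
  have E c : exponent al (i.*2 + c) = exponent al c + (i - j.+1)%:R + j.+1%:R.
    have iE : i%:R = (i - j.+1)%:R + j.+1%:R :> R.
      by rewrite -natrD; congr _%:R; lia.
    rewrite /exponent halfD oddD odd_double /= add0n doubleK natrD iE; ring.
  by rewrite !E /=; ring.
have hiE a b : \prod_(i.*2 + 4 <= j < k.+1.*2) (exponent al j - exponent al (i.*2 + a)) *
    \prod_(i.*2 + 4 <= j < k.+1.*2) (exponent al j - exponent al (i.*2 + b)) =
    \prod_(0 <= j < k - i.+1) ((j.+2%:R - exponent al a) * (j.+2%:R + al - exponent al a) *
      ((j.+2%:R - exponent al b) * (j.+2%:R + al - exponent al b))).
  rewrite -[(i.*2 + 4)%N]add0n !big_addn.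
  have -> : (k.+1.*2 - (i.*2 + 4) = (k - i.+1).*2)%N by lia.
  rewrite !big_nat_double -big_split; apply: eq_bigr => j _.
  have E c : exponent al (i.*2 + c) = exponent al c + i%:R.
    rewrite /exponent halfD oddD odd_double /= add0n doubleK natrD; ring.
  rewrite !E.
  have -> : (j.*2 + (i.*2 + 4) = (j.+2 + i).*2)%N by lia.
  have -> : (j.*2.+1 + (i.*2 + 4) = (j.+2 + i).*2.+1)%N by lia.
  rewrite exponent_even exponent_odd natrD /=; ring.
have e0 : exponent al 0 = 0 by rewrite /exponent mul0r addr0.
have e1 : exponent al 1 = al by rewrite /exponent /= mul1r add0r.
have e2 : exponent al 2 = 1 by rewrite /exponent /= mul0r addr0.
have e3 : exponent al 3 = 1 + al by rewrite /exponent /= mul1r.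
have shiftE (j : nat) : j.+2%:R = j.+1%:R + 1 :> R by rewrite natr1.
split.
  have := lowE 1%N 2%N; have := hiE 1%N 2%N; rewrite addn1 addn2 mulrACA => -> ->.
  by rewrite e1 e2; congr (_ * _); apply: eq_bigr => j _; rewrite shiftE; ring.
have := lowE 0%N 3%N; have := hiE 0%N 3%N; rewrite addn0 addn3 mulrACA => -> ->.
by rewrite e0 e3; congr (_ * _); apply: eq_bigr => j _; rewrite shiftE; ring.
Qed.

(** Keeping four of the 2k + 2 terms leaves three zeros, so [three_zeros_bound] applies to the
    weighted coefficients. By [block_bound] the weights, together with the factors (1 - al)^2 and (1
    + al)^2, can only help, and they cancel. *)
Lemma ratio_nondecreasing_step (R : realType) (al : R) (k i : nat) (p q : nat -> R)
    (z : seq R) :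
  0 < al < 1 -> (i < k)%N ->
  (forall j, (j <= k)%N -> 0 < p j) -> (forall j, (j <= k)%N -> 0 < q j) ->
  sorted <%R z -> (k.*2 < size z)%N ->
  (forall x, x \in z ->
     expsum k.+1.*2 (fun l => if odd l then - q l./2 else p l./2)
       (exponent al) x = 0) ->
  p i * q i.+1 <= p i.+1 * q i.
Proof.
move=> hal ik p0 q0 sz zk fz.
have lmn : (i.*2 + 4 <= k.+1.*2)%N by lia.
have [z' [szz pz' fz']] := keep_exponents lmn sz fz.
pose w := outer_weight k.+1.*2 (exponent al) i.*2 4.
have w0 j : (j < 4)%N -> 0 < w (i.*2 + j)%N.
  move=> j4; apply: outer_weight_gt0 => //; last by lia.
  by move=> a b /andP[ab _]; exact: exponent_lt.
have w00 : 0 < w i.*2 by have := w0 0%N isT; rewrite addn0.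
have w10 : 0 < w i.*2.+1 by have := w0 1%N isT; rewrite addn1.
have w20 : 0 < w i.*2.+2 by have := w0 2%N isT; rewrite addn2.
have w30 : 0 < w i.*2.+3 by have := w0 3%N isT; rewrite addn3.
have z'3 : (2 < size z')%N by lia.
have bnd := three_zeros_bound hal (mulr_gt0 (p0 i (ltnW ik)) w00)
  (mulr_gt0 (q0 i (ltnW ik)) w10) (mulr_gt0 (p0 i.+1 ik) w20)
  (mulr_gt0 (q0 i.+1 ik) w30) pz' z'3.
have {}bnd : p i * w i.*2 * (q i.+1 * w i.*2.+3) * (1 + al) ^+ 2 <=
    p i.+1 * w i.*2.+2 * (q i * w i.*2.+1) * (1 - al) ^+ 2.
  apply: bnd => x /fz'; rewrite /expsum 4!big_ord_recr big_ord0 /= -/w.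
  rewrite !(addn0, addn1, addn2, addn3) /= odd_double uphalf_double doubleK /=.
  rewrite exponent_odd -!doubleS exponent_even exponent_odd exponent_even.
  rewrite -natr1 !mulrDl !expRD mul1r => H.
  (* Removing the common factor brings the four exponents to 0, al, 1, 1 + al. *)
  have /mulfI := lt0r_neq0 (expR_gt0 (i%:R * x)); apply.
  by lra.
have [E1 E2] := outer_weight_blocks al ik.
rewrite -/w in E1 E2.
have /andP[L0 L1] := block_bound i hal.
have /andP[H0 H1] := block_bound (k - i.+1) hal.
have W : w i.*2.+1 * w i.*2.+2 * (1 - al) ^+ 2 <= w i.*2 * w i.*2.+3 * (1 + al) ^+ 2.
  rewrite E1 E2; have := ler_pM L0 H0 L1 H1.
  by rewrite mulrACA -expr2 [X in _ <= X]mulrACA -expr2.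
have a0 : 0 < 1 + al by case/andP: hal; lra.
have ww : 0 < w i.*2 * w i.*2.+3 * (1 + al) ^+ 2.
  by clearbody w; rewrite !mulr_gt0 // exprn_gt0.
rewrite -(ler_pM2r ww).
apply: (@le_trans _ _ (p i.+1 * q i * (w i.*2.+1 * w i.*2.+2 * (1 - al) ^+ 2))).
  by move: bnd; lra.
by rewrite ler_wpM2l // mulr_ge0 ?ltW ?p0 ?q0 // ltnW.
Qed.

(** * The rational interpolant of [t ^ al] *)

Lemma exists_root_between (R : realType) (f f' : R -> R) (u v : R) :
  (forall x : R, is_derive x 1%R f (f' x)) -> u <= v -> f u * f v < 0 ->
  exists2 c, u < c < v & f c = 0.
Proof.
move=> df uv fuv.
have [||c] := @IVT R f u v 0 uv.
- apply: continuous_subspaceT => x.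
  by apply/differentiable_continuous/derivable1_diffP; exact: ex_derive.
- rewrite ge_min le_max; move: fuv.
  by case: (lerP (f u) 0); case: (lerP (f v) 0) => //= ? ?; nra.
rewrite in_itv /= => /andP[uc cv] fc; exists c => //.
rewrite !lt_neqAle uc cv !andbT; apply/andP; split; apply/eqP => E.
  by move: fuv; rewrite E fc mul0r ltxx.
by move: fuv; rewrite -E fc mulr0 ltxx.
Qed.

(** The sign flips at each simple zero. The induction passes the first zero [a], moves the base
    point to some [y] before the next zero, and continues with [- f]. *)
Lemma sign_of_simple_zeros (R : realType) (z : seq R) (f f' : R -> R) (x0 x : R) :
  (forall x : R, is_derive x 1%R f (f' x)) ->
  path <%R x0 z -> 0 < f x0 ->
  (forall y, x0 < y -> f y = 0 -> y \in z) ->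
  (forall y, y \in z -> f y = 0) ->
  (forall y, y \in z -> f' y != 0) ->
  x0 <= x -> 0 <= (-1) ^+ count (< x) z * f x.
Proof.
elim: z f f' x0 => [|a z IH] f f' x0 df pz fx0 fz zf f'z x0x.
  rewrite expr0 mul1r leNgt; apply/negP => fx.
  have [|c /andP[x0c _] fc] := exists_root_between df x0x.
    by rewrite pmulr_rlt0.
  by have := fz c x0c fc.
move: pz => /= /andP[x0a pz].
have az y : y \in z -> a < y by move=> yz; exact: (allP (order_path_min lt_trans pz)).
have [xa|ax] := leP x a.
  have -> : count (< x) z = 0%N.
    apply/eqP; rewrite -leqn0 leqNgt -has_count; apply/hasPn => y /az ay.
    by rewrite /= -leNgt (le_trans xa) // ltW.
  rewrite expr0 mul1r leNgt; apply/negP => fx.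
  have [|c /andP[x0c cx] fc] := exists_root_between df x0x.
    by rewrite pmulr_rlt0.
  have := fz c x0c fc; rewrite inE => /predU1P[ca|/az ac].
    by move: cx; rewrite ca ltNge xa.
  by move: (lt_trans ac cx); rewrite ltNge xa.
(* [b] is the next zero or [x], whichever comes first; hence [a] is the only zero in the interval
   from [x0] to the midpoint [y] of [a] and [b]. *)
pose b := Num.min (head x z) x.
have ab : a < b.
  by rewrite /b lt_min ax andbT; case: (z) pz => //= ? ? /andP[].
have bz y : y \in z -> b <= y.
  move=> yz; rewrite /b ge_min; case: (z) pz yz => //= c s /andP[_ pc].
  rewrite inE => /predU1P[->|ys]; first by rewrite lexx.
  by rewrite (ltW (allP (order_path_min lt_trans pc) _ ys)).
pose y := (a + b) / 2.
have [ay yb] : a < y /\ y < b by rewrite /y; split; lra.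
have x0y : x0 < y by exact: lt_trans ay.
have yz : y \notin z by apply/negP => /bz; rewrite leNgt yb.
have onlya c : x0 < c -> c <= y -> f c = 0 -> c = a.
  move=> x0c cy /(fz c x0c); rewrite inE => /predU1P[//|/bz].
  by rewrite leNgt (le_lt_trans cy yb).
have fy0 : f y != 0.
  by apply/eqP => /(onlya y x0y (lexx _)) E; move: ay; rewrite E ltxx.
have fy : f y < 0.
  rewrite lt_neqAle fy0 leNgt; apply/negP => fy.
  have fa0 : f a = 0 by apply: zf; rewrite mem_head.
  (* If [f] were positive at [x0] and at [y], a negative value between them would force two distinct
     zeros there; so [a] would be a minimum, against [f' a != 0]. *)
  have : is_derive a 1%R f 0.
    apply: (@derive1_at_min R f x0 y a (ltW x0y)).
    - by move=> t _; exact: ex_derive.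
    - by rewrite in_itv /= x0a.
    move=> t; rewrite in_itv /= => /andP[x0t ty]; rewrite fa0 leNgt.
    apply/negP => ft.
    have [|c /andP[x0c ct] fc] := exists_root_between df (ltW x0t).
      by rewrite pmulr_rlt0.
    have [|d /andP[td dy] fd] := exists_root_between df (ltW ty).
      by rewrite pmulr_llt0.
    have ca : c = a by apply: onlya => //; apply/ltW/(lt_trans ct).
    have da : d = a by apply: onlya => //; [exact: lt_trans td|exact: ltW].
    by move: (lt_trans ct td); rewrite ca da ltxx.
  move=> da; have := derive_val (is_derive := df a).
  rewrite (derive_val (is_derive := da)) => E.
  by have := f'z a (mem_head _ _); rewrite -E eqxx.
have dN (t : R) : is_derive t 1%R (- f) (- f' t) by exact: is_deriveN.
rewrite add1n exprS mulN1r mulNr -mulrN.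
apply: (IH (- f) (fun t => - f' t) y dN).
- by move: pz bz; case: (z) => //= c s /andP[_ ->] /(_ c (mem_head _ _)) bc; rewrite andbT (lt_le_trans yb).
- by rewrite oppr_gt0.
- move=> t yt /eqP; rewrite oppr_eq0 => /eqP ft.
  have := fz t (lt_trans x0y yt) ft; rewrite inE => /predU1P[E|//].
  by move: yt; rewrite E ltNge (ltW ay).
- by move=> t tz; rewrite [LHS]/=  /GRing.opp /= zf ?oppr0 // inE tz orbT.
- by move=> t tz; rewrite oppr_eq0 f'z // inE tz orbT.
- by apply: ltW; apply: (lt_le_trans yb); rewrite /b ge_min lexx orbT.
Qed.

(* The substitution [t = exp x] turns [P(t) - t ^ al * Q(t)] into an exponential
   sum; coefficients of [P] and [Q] alternate. *)
Definition rat_coef (R : realType) (P Q : {poly R}) (l : nat) : R :=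
  if odd l then - Q`_l./2 else P`_l./2.

Lemma expsum_rat_coef (R : realType) (k : nat) (al : R) (P Q : {poly R}) (x : R) :
  (size P <= k.+1)%N -> (size Q <= k.+1)%N ->
  expsum k.+1.*2 (rat_coef P Q) (exponent al) x =
  P.[expR x] - expR (al * x) * Q.[expR x].
Proof.
move=> sP sQ; rewrite (horner_coef_wide _ sP) (horner_coef_wide _ sQ).
rewrite /expsum -(big_mkord xpredT (fun l => rat_coef P Q l * expR (exponent al l * x))).
rewrite big_nat_double big_mkord mulr_sumr -sumrB; apply: eq_bigr => i _ /=.
rewrite /rat_coef /= odd_double uphalf_double doubleK /= exponent_even exponent_odd.
by rewrite mulrDl expRD expRM_natl; ring.
Qed.

Section Interpolant.
Context {R : realType} (al : R) (k : nat) (P Q : {poly R}) (z : seq R).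
Context (hal : 0 < al < 1) (sP : (size P <= k.+1)%N) (sQ : (size Q <= k.+1)%N).
Context (Qmonic : Q \is monic) (sz : sorted <%R z) (zk : size z = k.*2.+1).
Context (zeros : forall x, x \in z -> P.[expR x] = expR (al * x) * Q.[expR x]).

Local Notation c := (rat_coef P Q).
Local Notation e := (exponent al).
Local Notation n := k.+1.*2.

Let e_lt i j : (i < j < n)%N -> e i < e j.
Proof. by move=> /andP[ij _]; exact: exponent_lt. Qed.

Let Fz x : x \in z -> expsum n c e x = 0.
Proof. by move=> /zeros E; rewrite expsum_rat_coef // E subrr. Qed.

(** The alternation of [rat_coef] gives all coefficients of [P] and [Q] one common sign, which the
    leading coefficient 1 of [Q] makes positive. *)
Lemma interpolant_coef_gt0 (j : nat) : (j <= k)%N -> 0 < P`_j /\ 0 < Q`_j.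
Proof.
have alt l : (l < n)%N -> exists2 t, 0 < t & c l = (-1) ^+ l * (t * c 0).
  elim: l => [_|l IH ln]; first by exists 1; rewrite // expr0 !mul1r.
  have [t t0 ct] := IH (ltnW ln).
  have nz : (n <= (size z).+1)%N by rewrite zk; lia.
  have [s s0 ->] := expsum_alternate e_lt sz nz Fz ln.
  exists (s * t); first exact: mulr_gt0.
  by rewrite ct exprS; ring.
have Q0 : (0 < size Q)%N by rewrite size_poly_gt0 monic_neq0.
have c0 : 0 < c 0.
  (* This is the index of the leading coefficient of [Q], whose degree is not yet known to be
     [k]. *)
  have [|t t0] := alt (size Q).-1.*2.+1; first by lia.
  rewrite /rat_coef /= odd_double uphalf_double /= exprS -signr_odd odd_double.
  rewrite expr0 mulr1 mulN1r => /oppr_inj E.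
  have := monicP Qmonic; rewrite /lead_coef E => E1.
  by rewrite -(pmulr_rgt0 _ t0) /rat_coef /= E1.
move=> jk; split.
  have [|t t0] := alt j.*2; first by lia.
  rewrite {1}/rat_coef odd_double doubleK -signr_odd odd_double expr0 mul1r => ->.
  exact: mulr_gt0.
have [|t t0] := alt j.*2.+1; first by lia.
rewrite {1}/rat_coef /= odd_double uphalf_double /= exprS -signr_odd odd_double.
rewrite expr0 mulr1 mulN1r => /oppr_inj ->.
exact: mulr_gt0.
Qed.

Lemma interpolant_ratio_le (i j : nat) :
  (i <= j <= k)%N -> P`_i * Q`_j <= P`_j * Q`_i.
Proof.
move=> /andP[/subnKC <-]; elim: (j - i)%N => [|d IH]; first by rewrite addn0.
rewrite addnS => dk; have {}IH := IH (ltnW dk).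
have dk' := ltnW dk.
have ik : (i <= k)%N by lia.
have [_ q0] := interpolant_coef_gt0 dk'.
have [_ q1] := interpolant_coef_gt0 dk.
have [_ qi] := interpolant_coef_gt0 ik.
have kz : (k.*2 < size z)%N by rewrite zk.
have step := @ratio_nondecreasing_step R al k (i + d) (fun j => P`_j) (fun j => Q`_j) z
  hal dk (fun j jk => (interpolant_coef_gt0 jk).1)
  (fun j jk => (interpolant_coef_gt0 jk).2) sz kz Fz.
rewrite -(ler_pM2r q0).
have := ler_wpM2r (ltW q1) IH; have := ler_wpM2r (ltW qi) step.
by rewrite /=; lra.
Qed.

(** Monotonicity of [P / Q] in cross-multiplied form. *)
Lemma interpolant_nondecreasing (s t : R) :
  0 < s -> s <= t -> P.[s] * Q.[t] <= P.[t] * Q.[s].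
Proof.
move=> s0 st; have t0 : 0 < t by exact: lt_le_trans st.
rewrite !(horner_coef_wide _ sP) !(horner_coef_wide _ sQ) -subr_ge0.
set D := _ - _.
have DE : D = \sum_(i < k.+1) \sum_(j < k.+1)
    P`_i * Q`_j * (t ^+ i * s ^+ j - s ^+ i * t ^+ j).
  rewrite /D !mulr_suml -sumrB; apply: eq_bigr => i _.
  rewrite !mulr_sumr -sumrB; apply: eq_bigr => j _; ring.
have DE' : D = \sum_(i < k.+1) \sum_(j < k.+1)
    - (P`_j * Q`_i * (t ^+ i * s ^+ j - s ^+ i * t ^+ j)).
  rewrite DE exchange_big; apply: eq_bigr => i _; apply: eq_bigr => j _; ring.
(* Symmetrizing in [i] and [j] turns each summand into a product of (p_i q_j - p_j q_i) and (t^i s^j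
   - s^i t^j), two factors that are both nonpositive for i <= j and both nonnegative for i > j. *)
have : 0 <= D + D; last by lra.
rewrite {1}DE DE' -big_split sumr_ge0 // => i _.
rewrite -big_split sumr_ge0 //= => j _; rewrite -mulrBl.
have pow (a b : nat) : (a <= b)%N -> t ^+ a * s ^+ b <= s ^+ a * t ^+ b.
  move=> /subnKC <-; rewrite !exprD !mulrA [s ^+ a * _]mulrC.
  rewrite ler_wpM2l ?mulr_ge0 ?exprn_ge0 ?(ltW s0) ?(ltW t0) //.
  by rewrite lerXn2r // nnegrE ltW.
have [ij|ji] := leqP i j.
  rewrite mulr_le0 // subr_le0; last exact: pow.
  by apply: interpolant_ratio_le; rewrite ij -ltnS ltn_ord.
rewrite mulr_ge0 // subr_ge0; first by apply: interpolant_ratio_le; rewrite ltnW // -ltnS ltn_ord.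
by have := pow _ _ (ltnW ji); lra.
Qed.

Let c_neq0 l : (l < n)%N -> c l != 0.
Proof.
move=> ln; have jk : (l./2 <= k)%N by rewrite -ltnS ltn_half_double.
have [p0 q0] := interpolant_coef_gt0 jk.
by rewrite /rat_coef; case: odd; rewrite ?oppr_eq0 lt0r_neq0.
Qed.

(** One more zero would make 2k + 2, as many as there are terms, and all coefficients would
    vanish. *)
Let z_all x : expsum n c e x = 0 -> x \in z.
Proof.
move=> Fx; apply: contraT => xz.
have szx : sorted <%R (sort <=%R (x :: z)).
  by rewrite sort_lt_sorted /= xz lt_sorted_uniq.
have nz : (n <= size (sort <=%R (x :: z)))%N by rewrite size_sort /= zk; lia.
have Fxz y : y \in sort <=%R (x :: z) -> expsum n c e y = 0.
  by rewrite mem_sort inE => /predU1P[->//|/Fz].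
have := expsum_eq0 e_lt szx nz Fxz (ltn0Sn _).
by move/eqP; rewrite (negbTE (c_neq0 _)).
Qed.

(* At a double zero the derivative, whose coefficient of exponent [0] vanishes,
   would have as many zeros as it has terms. *)
Let z_simple x : x \in z -> expsum n (fun l => c l * e l) e x != 0.
Proof.
move=> xz; apply/eqP => dFx.
have e0 : e 0 = 0 by rewrite /exponent mul0r addr0.
have dE y : expsum n (fun l => c l * (e l - 0)) e y = expsum n (fun l => c l * e l) e y.
  by apply: eq_bigr => l _; rewrite subr0.
move: sz zk Fz; case/splitPr: xz => s1 s2 sz' zk' Fz'.
have : sorted <%R (rcons s1 x) /\ path <%R x s2.
  move: sz'; rewrite -cat_rcons => sz'.
  have := cat_sorted2 sz' => -[-> _]; split => //.
  by move: sz'; rewrite cat_rcons => /cat_sorted2[].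
move=> [p1 p2].
(* Rolle on each side of [x], with [x] as an endpoint, yields as many critical points as there are
   other zeros; [x] itself is a further one, which makes 2k + 1. *)
have [s2' [ss2 ps2 _ fz2]] : exists s', [/\ size s' = size s2, path <%R x s',
    all (< last x s2) s' &
    forall y, y \in s' -> expsum n (fun l => c l * (e l - 0)) e y = 0].
  apply: rolle_expsum => // y ys; apply: Fz'; rewrite mem_cat ys orbT //.
have [s1' [ss1 ps1 ls1 fz1]] : exists s', [/\ size s' = size s1, sorted <%R s',
    all (< x) s' &
    forall y, y \in s' -> expsum n (fun l => c l * (e l - 0)) e y = 0].
  case: (s1) p1 Fz' => [|a s] /= p1 Fz'; first by exists [::].
  have [|s' [h1 h2 h3 h4]] := @rolle_expsum R n c e 0 a (rcons s x) p1.
    move=> y ys; apply: Fz'; move: ys; rewrite !inE mem_cat mem_rcons !inE.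
    by case/or3P => ->; rewrite ?orbT.
  rewrite size_rcons in h1; rewrite last_rcons in h3.
  by exists s'; split => //; exact: path_sorted h2.
pose s := s1' ++ x :: s2'.
have ss : sorted <%R s.
  rewrite /s lt_sorted_pairwise pairwise_cat -!lt_sorted_pairwise ps1 /= ps2 andbT.
  apply/allrelP => u v us; rewrite inE => /predU1P[->|vs]; first exact: (allP ls1).
  by apply: (lt_trans (allP ls1 _ us)); apply: (allP (order_path_min lt_trans ps2)).
have ns : (n <= (size s).+1)%N.
  by move: zk'; rewrite /s !size_cat /= ss1 ss2 => ->; rewrite doubleS.
have Fs y : y \in s -> expsum n (fun l => c l * e l) e y = 0.
  rewrite /s mem_cat inE => /or3P[/fz1|/eqP->|/fz2] //; rewrite dE //.
(* The coefficient at exponent 0 being zero, so would be the next one, [c 1 * al]. *)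
have [t t0] := expsum_alternate e_lt ss ns Fs (l := 0) isT.
rewrite e0 !mulr0 oppr0 => /eqP; rewrite mulf_eq0 (negbTE (c_neq0 _)) //=.
by apply/negP; rewrite lt0r_neq0 // -e0 e_lt.
Qed.

(** Far to the left the function is close to the constant coefficient of [P], hence positive; from
    there on, [sign_of_simple_zeros] counts the sign changes. *)
Lemma interpolant_error_sign (x : R) :
  0 <= (-1) ^+ count (< x) z * (P.[expR x] - expR (al * x) * Q.[expR x]).
Proof.
have /andP[al0 al1] := hal.
have [p0 _] := interpolant_coef_gt0 (leq0n k).
have pos (p : {poly R}) t : (size p <= k.+1)%N ->
    (forall j, (j <= k)%N -> 0 < p`_j) -> 0 <= t <= 1 ->
    p`_0 <= p.[t] <= p.[1].
  move=> sp pp /andP[t0 t1]; rewrite !(horner_coef_wide _ sp); apply/andP; split.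
    rewrite big_ord_recl expr0 mulr1 lerDl sumr_ge0 // => i _.
    by rewrite mulr_ge0 ?exprn_ge0 // ltW // pp // -ltnS ltn_ord.
  apply: ler_sum => i _; rewrite expr1n ler_wpM2l ?exprn_ile1 //.
  by rewrite ltW // pp // -ltnS ltn_ord.
have ppos j : (j <= k)%N -> 0 < P`_j by move=> /interpolant_coef_gt0[].
have qpos j : (j <= k)%N -> 0 < Q`_j by move=> /interpolant_coef_gt0[].
have B0 : 0 < Q.[1].
  apply: (lt_le_trans (qpos _ (leq0n k))).
  have i01 : 0 <= (0 : R) <= 1 by rewrite lexx ler01.
  by have /andP[/le_trans] := pos Q 0 sQ qpos i01; apply.
(* The base point precedes all zeros and does not exceed [x]; moreover [expR y] is at most 1 and
   [expR (al * y) * Q.[1]] at most half of the constant coefficient of [P]. *)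
pose y := Num.min (head x z - 1) (Num.min (Num.min x 0) (ln (P`_0 / Q.[1] / 2) / al)).
have yx : y <= x by rewrite /y !ge_min lexx !orbT.
have y0 : y <= 0 by rewrite /y !ge_min lexx !orbT.
have yl : y <= ln (P`_0 / Q.[1] / 2) / al by rewrite /y !ge_min lexx !orbT.
have yh : y <= head x z - 1 by rewrite /y !ge_min lexx.
rewrite -(@expsum_rat_coef _ k) //.
apply: (@sign_of_simple_zeros R z _ _ y x (is_derive_expsum n c e)) => //.
- move: sz yh; case: (z) => //= a s -> yh; rewrite andbT; lra.
- rewrite expsum_rat_coef // subr_gt0.
  have ey : 0 <= expR y <= 1 by rewrite expR_ge0 -expR0 ler_expR.
  have /andP[Py _] := pos P _ sP ppos ey; have /andP[_ Qy] := pos Q _ sQ qpos ey.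
  apply: lt_le_trans Py.
  have cpos : 0 < P`_0 / Q.[1] / 2 by rewrite !divr_gt0.
  have Ey : expR (al * y) <= P`_0 / Q.[1] / 2.
    by rewrite -[leRHS]lnK ?posrE // ler_expR mulrC -ler_pdivlMr.
  apply: (@le_lt_trans _ _ (P`_0 / Q.[1] / 2 * Q.[1])).
    have Q0 : 0 <= Q.[expR y].
      by have /andP[+ _] := pos Q _ sQ qpos ey; apply: le_trans; exact: ltW (qpos _ _).
    by apply: ler_pM.
  by rewrite mulrAC divfK ?lt0r_neq0 //; lra.
- by move=> t _ /z_all.
Qed.

End Interpolant.

(** * Symmetric matrices *)

Lemma row_sqnorm_gt0 (R : realType) (n : nat) (v : 'rV[R]_n) :
  v != 0 -> 0 < (v *m v^T) 0 0.
Proof.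
move=> v0; rewrite mxE lt_neqAle eq_sym psumr_neq0; last first.
  by move=> i _; rewrite mxE -expr2 sqr_ge0.
rewrite sumr_ge0 ?andbT; last by move=> i _; rewrite mxE -expr2 sqr_ge0.
have /rV0Pn[i vi] := v0.
by apply/hasP; exists i; rewrite ?mem_index_enum //= mxE -expr2 exprn_even_gt0.
Qed.

(* The Householder reflection exchanging [v] and the first basis vector. *)
Lemma unit_row_completion (R : realType) (n : nat) (v : 'rV[R]_n.+1) :
  v *m v^T = 1%:M -> exists2 H : 'M[R]_n.+1, H *m H^T = 1%:M & row 0 H = v.
Proof.
move=> vv; have [->|ve] := eqVneq v (delta_mx 0 0).
  by exists 1%:M; rewrite ?trmx1 ?mulmx1 // row1.
pose e : 'rV[R]_n.+1 := delta_mx 0 0; pose w := e - v; pose s := 1 - v 0 0.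
have ve' : v *m e^T = (v 0 0)%:M.
  by rewrite /e trmx_delta -colE; apply/matrixP => i j; rewrite !ord1 !mxE.
have ev : e *m v^T = (v 0 0)%:M by rewrite -[LHS]trmxK trmx_mul trmxK ve' tr_scalar_mx.
have ee : e *m e^T = 1%:M.
  by rewrite /e trmx_delta mul_delta_mx; apply/matrixP => i j; rewrite !ord1 !mxE.
have ew : e *m w^T = s%:M.
  by rewrite /w linearB /= mulmxBr ee ev /s raddfB.
have ww : w *m w^T = (s *+ 2)%:M.
  rewrite {1}/w mulmxBl ew /w linearB /= mulmxBr vv ve'.
  by apply/matrixP => i j; rewrite !ord1 !mxE /s; ring.
have s0 : s != 0.
  apply/eqP => s0; have /row_sqnorm_gt0 : w != 0 by rewrite subr_eq0 eq_sym.
  by rewrite ww s0 mul0rn !mxE mul0rn ltxx.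
(* As [w] has squared length 2s, [K] is twice the orthogonal projection onto [w], and [1%:M - K] is
   the reflection. *)
pose K := s^-1 *: (w^T *m w).
have KT : K^T = K by rewrite /K linearZ /= trmx_mul trmxK.
have KK : K *m K = K *+ 2.
  rewrite /K -scalemxAl -scalemxAr mulmxA -(mulmxA w^T) ww mul_mx_scalar.
  by rewrite -scalemxAl !scalerA mulr2n mulrDr mulVf // mulrDr mulr1 scalerDl.
exists (1%:M - K).
  rewrite linearB /= trmx1 KT mulmxBl mul1mx mulmxBr mulmx1 KK mulr2n.
  by rewrite opprB addrK subrK.
rewrite rowE -/e mulmxBr /K mulmx1 -scalemxAr mulmxA ew mul_scalar_mx scalerA.
by rewrite mulVf // scale1r /w opprB addrC subrK.
Qed.

Lemma char_poly_orthogonal_conj (R : realType) (n : nat) (A H : 'M[R]_n) :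
  H *m H^T = 1%:M -> char_poly (H *m A *m H^T) = char_poly A.
Proof.
move=> HH; rewrite /char_poly.
have -> : char_poly_mx (H *m A *m H^T) =
    map_mx polyC H *m char_poly_mx A *m map_mx polyC H^T.
  rewrite /char_poly_mx mulmxBr mulmxBl !map_mxM /=; congr (_ - _).
  rewrite scalar_mxC -mulmxA -map_mxM HH map_mx1 mulmx1 //.
rewrite !det_mulmx mulrAC -det_mulmx -map_mxM HH map_mx1 det1 mul1r //.
Qed.

(** Deflation: in an orthonormal basis starting with a unit eigenvector, symmetry splits off a 1 x 1
    block, and cancelling its linear factor leaves a split characteristic polynomial for the other
    block. *)
Lemma symmetric_diagonalization (R : realType) (n : nat) (A : 'M[R]_n) (s : seq R) :
  A^T = A -> char_poly A = \prod_(a <- s) ('X - a%:P) ->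
  exists (U : 'M[R]_n) (d : 'rV[R]_n),
    U *m U^T = 1%:M /\ A = U^T *m diag_mx d *m U.
Proof.
elim: n A s => [|n IH] A s At cA.
  by exists 1%:M, 0; split; apply/matrixP => -[].
have : size s = n.+1.
  by have := size_char_poly A; rewrite cA size_prod_XsubC => -[].
case: s cA => [//|a s] cA _.
have /eigenvalueP[v0 v0A v00] : eigenvalue A a.
  by rewrite eigenvalue_root_char cA root_prod_XsubC mem_head.
pose v := (Num.sqrt ((v0 *m v0^T) 0 0))^-1 *: v0.
have vv : v *m v^T = 1%:M.
  rewrite /v linearZ /= -scalemxAl -scalemxAr scalerA -invfM -expr2.
  rewrite sqr_sqrtr ?ltW ?row_sqnorm_gt0 //.
  apply/matrixP => i j; rewrite !ord1 [LHS]mxE mulVf ?lt0r_neq0 ?row_sqnorm_gt0 //.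
  by rewrite !mxE.
have vA : v *m A = a *: v.
  by rewrite /v -scalemxAl v0A !scalerA mulrC.
have [H HH Hv] := unit_row_completion vv.
have HH' := mulmx1C HH.
have [B BD] : exists B : 'M[R]_(1 + n), B = H *m A *m H^T by eexists.
have Bt : B^T = B by rewrite BD !trmx_mul trmxK At mulmxA.
have B0 : row 0 B = a *: delta_mx 0 0.
  rewrite BD !row_mul Hv vA -scalemxAl; congr (_ *: _).
  by rewrite -Hv rowE -mulmxA HH mulmx1.
have Bb : B = block_mx a%:M 0 0 (drsubmx B).
  have ur : ursubmx B = 0.
    apply/rowP => j; rewrite mxE [RHS]mxE.
    have := congr1 (fun M : 'rV_(1 + n) => M 0 (rshift 1 j)) B0.
    rewrite !mxE /= => E; rewrite [X in B X _](_ : _ = 0) ?E; last exact: val_inj.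
    by rewrite mulr0.
  have dl : dlsubmx B = 0 by rewrite -[dlsubmx B]trmxK trmx_dlsub Bt ur trmx0.
  have ul : ulsubmx B = a%:M.
    apply/matrixP => i j; rewrite !ord1 !mxE.
    have := congr1 (fun M : 'rV_(1 + n) => M 0 0) B0.
    rewrite !mxE mulr1 => E.
    by rewrite [X in B X _](_ : _ = 0) ?[X in B _ X](_ : _ = 0) ?E //; exact: val_inj.
  by rewrite -[LHS]submxK ur dl ul.
have At' : (drsubmx B)^T = drsubmx B by rewrite trmx_drsub Bt.
have cB : char_poly (drsubmx B) = \prod_(b <- s) ('X - b%:P).
  have : char_poly B = char_poly A by rewrite BD; exact: char_poly_orthogonal_conj.
  rewrite cA big_cons {1}Bb /char_poly /char_poly_mx map_block_mx scalar_mx_block.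
  rewrite opp_block_mx add_block_mx !map_mx0 !oppr0 !addr0 det_ublock.
  rewrite map_scalar_mx /= -raddfB det_scalar1 => /mulfI; apply.
  by rewrite polyXsubC_eq0.
have [U' [d' [UU' BE]]] := IH _ _ At' cB.
pose U1 : 'M[R]_(1 + n) := block_mx 1%:M 0 0 U'.
have UU1 : U1 *m U1^T = 1%:M.
  rewrite /U1 tr_block_mx mulmx_block !trmx0 trmx1 !(mul0mx, mulmx0, mulmx1, addr0, add0r).
  by rewrite UU' -scalar_mx_block.
exists (U1 *m H), (row_mx a%:M d'); split.
  by rewrite trmx_mul mulmxA -(mulmxA U1) HH mulmx1.
have BU : B = U1^T *m diag_mx (row_mx a%:M d') *m U1.
  rewrite diag_mx_row /U1 tr_block_mx !trmx0 trmx1 !mulmx_block.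
  rewrite !(mul0mx, mulmx0, mulmx1, mul1mx, addr0, add0r) -BE {1}Bb.
  congr block_mx; apply/matrixP => i j; by rewrite !ord1 !mxE.
rewrite trmx_mul -!mulmxA [diag_mx _ *m _]mulmxA [U1^T *m _]mulmxA.
rewrite [U1^T *m _]mulmxA -BU BD.
by rewrite !mulmxA HH' mul1mx -!mulmxA HH' mulmx1.
Qed.

(** Read the eigenvalue equation in the row where the entry of [x] is largest in absolute value. *)
Lemma norm_eigenvalue_le (R : realType) (n : nat) (A : 'M[R]_n) (x : 'cV[R]_n) (a : R) :
  A *m x = a *: x -> x != 0 -> `|a| <= norm_inf A.
Proof.
move=> Ax /cV0Pn[i0 xi0].
have [j _ xj] := @arg_maxP _ R _ i0 xpredT (fun i => `|x i 0|) isT.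
have xj0 : 0 < `|x j 0| by apply: lt_le_trans (xj i0 isT); rewrite normr_gt0.
apply: (@le_trans _ _ (\sum_(l < n) `|A j l|)); last exact: le_bigmax.
rewrite -(ler_pM2r xj0) -normrM.
have <- : (A *m x) j 0 = a * x j 0 by rewrite Ax mxE.
rewrite mxE mulr_suml; apply: le_trans (ler_norm_sum _ _ _) _.
by apply: ler_sum => l _; rewrite normrM ler_wpM2l //; exact: xj.
Qed.

Lemma norm2_orthogonal (R : realType) (n : nat) (U : 'M[R]_n) (v : 'cV[R]_n) :
  U^T *m U = 1%:M -> norm2 (U *m v) = norm2 v.
Proof.
move=> UU.
have E (w : 'cV[R]_n) : \sum_i w i 0 ^+ 2 = (w^T *m w) 0 0.
  by rewrite mxE; apply: eq_bigr => i _; rewrite mxE expr2.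
by rewrite /norm2 !E trmx_mul mulmxA -(mulmxA v^T) UU mulmx1.
Qed.

Lemma norm2_gt0 (R : realType) (n : nat) (v : 'cV[R]_n) : v != 0 -> 0 < norm2 v.
Proof.
move=> /cV0Pn[i vi]; rewrite sqrtr_gt0 (bigD1 i) //= ltr_wpDr //.
  by apply: sumr_ge0 => j _; exact: sqr_ge0.
by rewrite exprn_even_gt0.
Qed.

Lemma norm2_diag_le (R : realType) (n : nat) (d : 'rV[R]_n) (M : R) (v : 'cV[R]_n) :
  0 <= M -> (forall i, `|d 0 i| <= M) -> norm2 (diag_mx d *m v) <= M * norm2 v.
Proof.
move=> M0 dM; rewrite -(ger0_norm M0) -sqrtr_sqr /norm2 -sqrtrM ?sqr_ge0 //.
apply: ler_wsqrtr; rewrite mulr_sumr; apply: ler_sum => i _.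
rewrite mul_diag_mx mxE exprMn ler_wpM2r ?sqr_ge0 //.
by rewrite -(real_normK (num_real (d 0 i))) lerXn2r // nnegrE.
Qed.

Lemma mxfunE (R : realType) (n : nat) (g : R -> R) (U : 'M[R]_n) (d : 'rV[R]_n) :
  U *m U^T = 1%:M ->
  mxfun g (U^T *m diag_mx d *m U) = U^T *m diag_mx (map_mx g d) *m U.
Proof.
move=> UU; set A := U^T *m diag_mx d *m U; set B := RHS.
have AB : spectral_image g A B by exists U, d.
rewrite /mxfun; case: xgetP => [C _ AC|/(_ B)/(_ AB)//].
exact: spectral_image_unique AC AB.
Qed.

Lemma invmx_diag_conj (R : realType) (n : nat) (U : 'M[R]_n) (d : 'rV[R]_n) :
  U *m U^T = 1%:M -> (forall i, d 0 i != 0) ->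
  invmx (U^T *m diag_mx d *m U) = U^T *m diag_mx (map_mx GRing.inv d) *m U.
Proof.
move=> UU d0; set B := U^T *m diag_mx d *m U; set C := RHS.
have BC : B *m C = 1%:M.
  rewrite /B /C !mulmxA -(mulmxA (_ *m diag_mx d)) UU mulmx1.
  rewrite -(mulmxA U^T) mulmx_diag (_ : diag_mx _ = 1%:M) ?mulmx1 ?(mulmx1C UU) //.
  rewrite -diag_const_mx; congr diag_mx; apply/rowP => i.
  by rewrite !mxE mulfV.
have [Bu _] := mulmx1_unit BC.
by rewrite -[LHS]mulmx1 -BC mulKmx.
Qed.

(** * Lower bound for the approximant and error on the spectrum *)

Lemma horner_gt0_coef (R : realType) (k : nat) (p : {poly R}) (t : R) :
  (size p <= k.+1)%N -> (forall j, (j <= k)%N -> 0 < p`_j) -> 0 < t -> 0 < p.[t].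
Proof.
move=> sp pp t0; rewrite (horner_coef_wide _ sp) big_ord_recl ltr_wpDr //.
  apply: sumr_ge0 => i _; rewrite mulr_ge0 ?exprn_ge0 ?ltW // pp // -ltnS ltn_ord //.
by rewrite expr0 mulr1 pp.
Qed.

(** Monotonicity reduces the claim to [mu], where an even number of roots lies below and the error
    is therefore nonnegative. *)
Lemma rational_interpolant_ge (R : realType) (al : R) (k : nat) (P Q : {poly R})
    (xi : nat -> R) (i : nat) (mu t : R) :
  0 < al < 1 -> (size P <= k.+1)%N -> (size Q <= k.+1)%N -> Q \is monic ->
  (forall a b : nat, (1 <= a)%N -> (a < b)%N -> (b <= 2 * k + 1)%N -> xi a < xi b) ->
  (forall j, (1 <= j <= 2 * k + 1)%N ->
     0 < xi j /\ P.[xi j] / Q.[xi j] = xi j `^ al) ->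
  (1 <= i <= k)%N -> xi (2 * i)%N <= mu <= xi (2 * i + 1)%N -> mu <= t ->
  mu `^ al <= P.[t] / Q.[t].
Proof.
move=> hal sP sQ Qm xi_lt xi_root ik /andP[xmu mux] mut.
have powE y : 0 < y -> y `^ al = expR (al * ln y).
  by move=> y0; rewrite /powR gt_eqF.
pose z := [seq ln (xi j) | j <- iota 1 k.*2.+1].
have jin j : (j \in iota 1 k.*2.+1) = (1 <= j <= 2 * k + 1)%N.
  by rewrite mem_iota; apply/idP/idP; lia.
have xi_gt0 j : (1 <= j <= 2 * k + 1)%N -> 0 < xi j by case/xi_root.
have ln_lt a b : (1 <= a)%N -> (a < b)%N -> (b <= 2 * k + 1)%N -> ln (xi a) < ln (xi b).
  move=> a1 ab bk.
  by rewrite ltr_ln ?posrE ?xi_gt0 //; [exact: xi_lt|lia|lia].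
have sz : sorted <%R z.
  rewrite lt_sorted_pairwise; apply/(pairwiseP 0) => a b.
  rewrite !inE size_map size_iota => ak bk ab.
  rewrite !(nth_map 0%N) ?size_iota // !nth_iota //.
  by apply: ln_lt; lia.
have zk : size z = k.*2.+1 by rewrite size_map size_iota.
have zeros x : x \in z -> P.[expR x] = expR (al * x) * Q.[expR x].
  move=> /mapP[j]; rewrite jin => /xi_root[j0 Ej] ->.
  rewrite -powE // lnK ?posrE // -Ej divfK //.
  (* A zero of [Q] here would give the quotient its default value 0, but the power is positive. *)
  apply/eqP => Q0; move: Ej; rewrite Q0 invr0 mulr0 => /esym/eqP.
  by rewrite gt_eqF ?powR_gt0.
have x20 : 0 < xi (2 * i)%N by apply: xi_gt0; lia.
have mu0 : 0 < mu by exact: lt_le_trans xmu.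
have t0 : 0 < t by exact: lt_le_trans mut.
have Qpos y : 0 < y -> 0 < Q.[y].
  by apply: (horner_gt0_coef sQ) => j jk; have [] := interpolant_coef_gt0 hal sP sQ Qm sz zk zeros jk.
have mono := interpolant_nondecreasing hal sP sQ Qm sz zk zeros mu0 mut.
have Fmu : mu `^ al * Q.[mu] <= P.[mu].
  (* The strict count would be 2i - 1 at the left endpoint, so the equality there is taken from the
     root itself. *)
  have [E|xmu'] := eqVneq (xi (2 * i)%N) mu.
    have [] : 0 < xi (2 * i)%N /\ P.[xi (2 * i)%N] / Q.[xi (2 * i)%N] = xi (2 * i)%N `^ al.
      by apply: xi_root; clear -ik; lia.
    by rewrite E => _ <-; rewrite divfK ?lt0r_neq0 ?Qpos.
  have {xmu'}xmu : xi (2 * i)%N < mu by rewrite lt_neqAle xmu'.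
  have := interpolant_error_sign hal sP sQ Qm sz zk zeros (ln mu).
  rewrite lnK ?posrE // -powE // (_ : count _ z = i.*2).
    by rewrite -signr_odd odd_double mul1r subr_ge0.
  rewrite count_map (_ : k.*2.+1 = i.*2 + (k.*2.+1 - i.*2))%N;
    last by clear -ik; lia.
  rewrite iotaD count_cat; apply/eqP; rewrite -[X in _ == X]addn0; apply/eqP; congr addn.
    rewrite -[RHS](size_iota 1); apply/eqP; rewrite -all_count; apply/allP => j.
    rewrite mem_iota => ji /=.
    apply: (@le_lt_trans _ _ (ln (xi (2 * i)%N))).
      have [->//|ji'] := eqVneq j (2 * i)%N.
      by apply/ltW/ln_lt; clear -ik ji ji'; lia.
    by rewrite ltr_ln ?posrE.
  apply/eqP; rewrite -leqn0 leqNgt -has_count; apply/hasPn => j.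
  rewrite mem_iota => ji /=; rewrite -leNgt.
  apply: (@le_trans _ _ (ln (xi (2 * i + 1)%N))).
    by rewrite ler_ln ?posrE // (lt_le_trans x20) // ltW // xi_lt //; clear -ik; lia.
  have [->//|ji'] := eqVneq j (2 * i + 1)%N.
  by apply/ltW/ln_lt; clear -ik ji ji'; lia.
rewrite ler_pdivlMr ?Qpos // -(ler_pM2r (Qpos mu mu0)).
apply: le_trans mono; rewrite mulrAC ler_wpM2r // ltW // Qpos //.
Qed.

(** After extracting L^(-al), the difference of reciprocals is (t^al - rt) / (rt t^al), where both
    factors of the denominator are at least mu^al. *)
Lemma scaled_error_le (R : realType) (al L mu t rt E : R) :
  0 < L -> 0 < mu -> mu <= t -> 0 <= al -> mu `^ al <= rt -> `|rt - t `^ al| <= E ->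
  `|L `^ (- al) * rt^-1 - (L * t) `^ (- al)| <= L `^ al * E / (L * mu) `^ (2 * al).
Proof.
move=> L0 mu0 mut al0 rmu rE.
have t0 : 0 < t by exact: lt_le_trans mut.
rewrite !powRN !powRM ?(ltW L0) ?(ltW mu0) ?(ltW t0) // [2 * al]mulrC !powRrM.
rewrite !powR_mulrn ?powR_ge0 //.
set l := L `^ al; set m := mu `^ al; set u := t `^ al.
have l0 : 0 < l by exact: powR_gt0.
have m0 : 0 < m by exact: powR_gt0.
have mu' : m <= u by apply: ge0_ler_powR => //; rewrite nnegrE ltW.
have r0 : 0 < rt by exact: lt_le_trans rmu.
have u0 : 0 < u by exact: lt_le_trans mu'.
have -> : l^-1 * rt^-1 - (l * u)^-1 = l^-1 * ((u - rt) / (rt * u)).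
  by field; rewrite !lt0r_neq0.
have -> : l * E / (l ^+ 2 * m ^+ 2) = l^-1 * (E / m ^+ 2).
  by field; rewrite !lt0r_neq0.
rewrite normrM normrV ?unitfE ?lt0r_neq0 // (gtr0_norm l0).
rewrite ler_pM2l ?invr_gt0 //.
have ru0 : 0 < rt * u by exact: mulr_gt0.
rewrite normrM normrV ?unitfE ?(lt0r_neq0 ru0) // (gtr0_norm ru0) distrC.
apply: ler_pM => //; first by rewrite invr_ge0 ltW.
rewrite lef_pV2 ?posrE ?exprn_gt0 // expr2.
by apply: ler_pM => //; exact: ltW.
Qed.

Unset Implicit Arguments.

Theorem mainTheorem2 (R : realType) (N : nat) (A : 'M[R]_N) (lam : nat -> R)
    (alpha : R) (k : nat) (f : 'cV[R]_N) (r : R -> R) (E : R) (xi : nat -> R)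
    (hA : sympd A)
    (hlam : ordered_eigenvalues A lam) (hlam1 : 0 < lam 1%N)
    (halpha : 0 < alpha < 1) (hk : (0 < k)%N) (hf : f != 0)
    (hr : best_approx k k (fun t => t `^ alpha) r)
    (hE : is_max [set `|r t - t `^ alpha| | t in [set` `[0, 1]]] E)
    (hxi_lt : forall i j : nat, (1 <= i)%N -> (i < j)%N -> (j <= 2 * k + 1)%N ->
       xi i < xi j)
    (hxi_roots : [set t | 0 < t < 1 /\ r t - t `^ alpha = 0] =
       [set xi i | i in [set i | (1 <= i <= 2 * k + 1)%N]]) :
  let Lambda : R := norm_inf A in
  let cA : 'M[R]_N := Lambda^-1 *: A in
  let mu1 : R := Lambda^-1 * lam 1%N in
  let u : 'cV[R]_N := mxfun (fun t => t `^ (- alpha)) A *m f in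
  let ur : 'cV[R]_N := Lambda `^ (- alpha) *: (invmx (mxfun r cA) *m f) in
  (\bigcup_(i in [set i | (1 <= i <= k)%N])
      [set` `[xi (2 * i)%N, xi (2 * i + 1)%N]]) mu1 ->
  norm2 (ur - u) / norm2 f <= Lambda `^ alpha * E / lam 1%N `^ (2 * alpha).
Proof.
move=> Lambda cA mu1 u ur [i /= ik]; rewrite in_itv /= => mu_in.
have [[P [Q [sP sQ Qm rE]]] _] := hr.
have [At _] := hA.
have [lam_le cA_lam] := hlam.
have [U [d [UU AE]]] : exists (U : 'M[R]_N) (d : 'rV[R]_N),
    U *m U^T = 1%:M /\ A = U^T *m diag_mx d *m U.
  apply: (@symmetric_diagonalization _ _ _ [seq lam j | j <- index_iota 1 N.+1] At).
  by rewrite big_map.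
have UU' := mulmx1C UU.
have rowU j : row j U *m A = d 0 j *: row j U.
  rewrite AE !mulmxA -row_mul UU row1 -rowE row_diag_mx -scalemxAl.
  by rewrite -rowE.
have rowU0 j : row j U != 0.
  apply/eqP => /(congr1 (fun v => v *m U^T)); rewrite -row_mul UU mul0mx row1.
  by move=> /rowP/(_ j); rewrite !mxE !eqxx => /eqP; rewrite oner_eq0.
have lam1_le j : lam 1%N <= d 0 j.
  have : eigenvalue A (d 0 j) by apply/eigenvalueP; exists (row j U).
  rewrite eigenvalue_root_char cA_lam -(big_map lam xpredT (fun a => 'X - a%:P)).
  rewrite root_prod_XsubC => /mapP[m]; rewrite mem_index_iota => m_in ->.
  by apply: lam_le; clear -m_in; lia.
have d_le j : d 0 j <= Lambda.
  apply: le_trans (ler_norm _) _.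
  apply: (@norm_eigenvalue_le _ _ _ (row j U)^T); last by rewrite trmx_eq0.
  by rewrite -{1}At -trmx_mul rowU linearZ.
(* A nonzero [f] provides an index, so the matrix is not empty and [Lambda] is positive. *)
have [j0 _] := cV0Pn _ hf.
have L0 : 0 < Lambda by rewrite (lt_le_trans hlam1) // (le_trans (lam1_le j0)).
have mu0 : 0 < mu1 by rewrite mulr_gt0 // invr_gt0.
have lamE : lam 1%N = Lambda * mu1 by rewrite /mu1 mulVKf // lt0r_neq0.
have rootP j : (1 <= j <= 2 * k + 1)%N ->
    0 < xi j /\ P.[xi j] / Q.[xi j] = xi j `^ alpha.
  move=> jk; have : [set xi i | i in [set i | (1 <= i <= 2 * k + 1)%N]] (xi j) by exists j.
  by rewrite -hxi_roots /= rE => -[/andP[? _] /subr0_eq].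
have al0 : 0 <= alpha by case/andP: halpha => /ltW.
pose t j := Lambda^-1 * d 0 j.
have mut j : mu1 <= t j by rewrite ler_wpM2l // invr_ge0 ltW.
have r_ge j : mu1 `^ alpha <= r (t j).
  rewrite rE; apply: (rational_interpolant_ge halpha sP sQ Qm hxi_lt rootP ik mu_in).
  exact: mut.
have t_le1 j : t j <= 1.
  by rewrite /t mulrC ler_pdivrMr // mul1r.
have errE j : `|r (t j) - t j `^ alpha| <= E.
  have [_ ub] := hE; apply: ub; exists (t j) => //=.
  by rewrite in_itv /= t_le1 andbT (le_trans (ltW mu0)).
(* The eigenvalues of the error operator in the common eigenbasis [U]; it remains to bound each of
   them. *)
pose delta := \row_j (Lambda `^ (- alpha) * (r (t j))^-1 - d 0 j `^ (- alpha)).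
have uE : ur - u = U^T *m (diag_mx delta *m (U *m f)).
  have cAE : cA = U^T *m diag_mx (Lambda^-1 *: d) *m U.
    by rewrite /cA AE linearZ /= -scalemxAr -scalemxAl.
  rewrite /ur /u cAE AE !mxfunE // invmx_diag_conj //; last first.
    move=> j; rewrite !mxE lt0r_neq0 // (lt_le_trans _ (r_ge j)) //.
    exact: powR_gt0.
  rewrite -!mulmxA scalemxAr -mulmxBr scalemxAl -mulmxBl; congr (_ *m (_ *m _)).
  apply/matrixP => a b; rewrite !mxE.
  by case: eqP => _; rewrite ?mulr0n ?mulr1n ?mulr0 ?subr0.
set M := _ * E / _.
have M_ge j : `|delta 0 j| <= M.
  rewrite mxE /M lamE.
  have -> : d 0 j = Lambda * t j by rewrite /t mulVKf // lt0r_neq0.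
  exact: scaled_error_le.
have M0 : 0 <= M by exact: le_trans (M_ge j0).
rewrite ler_pdivrMr ?norm2_gt0 // uE norm2_orthogonal ?trmxK //.
by apply: le_trans (norm2_diag_le _ M0 M_ge) _; rewrite norm2_orthogonal.
Qed.
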